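(* Let $q$ be a prime power, let $d\geq 2$ be an integer such that $d\not\equiv 0\pmod 4$, and let $f(x)=x^{d}-a\in\mathbb{F}_q[x]$ with $a\neq 0$. Let $\delta=\gcd(q-1,d)$. Suppose that $P_n(a)\neq 0$ for every positive integer $n$. If $f_1(x),\ldots,f_{(q-1)/\delta+1}(x)$ are irreducible over $\mathbb{F}_q$, then $f(x)$ is stable over $\mathbb{F}_q$.
   Context: $\mathbb{F}_q$ is the finite field with $q$ elements. For the fixed integer $d\ge 2$, the polynomials $P_n(x)$, $n\geq 1$, are defined inductively by $P_1(x)=x$ and $P_n(x)=[P_{n-1}(x)]^{d}+(-1)^{d-1}x$ for $n\geq 2$. The iterates of $f$ are $f_0(x)=x$, $f_1(x)=f(x)$, $f_n(x)=f_{n-1}(f(x))$ for $n\geq 2$; $f$ is stable over a field $K$ if $f_n(x)$ is irreducible over $K$ for all $n\ge 0$. *)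

(* Defs.v *)
From mathcomp Require Import all_boot all_order all_algebra all_field.
Set Implicit Arguments.
Unset Strict Implicit.
Unset Printing Implicit Defensive.
Import GRing.Theory.
Local Open Scope ring_scope.

Fixpoint poly_iter (R : nzRingType) (f : {poly R}) (n : nat) : {poly R} :=
  if n is m.+1 then poly_iter f m \Po f else 'X.

Definition stable (K : fieldType) (f : {poly K}) : Prop :=
  forall n : nat, irreducible_poly (poly_iter f n).

(* The sequence is indexed from 1; the value 0 at index 0 is a dummy. *)
Fixpoint crit_poly (R : nzRingType) (d n : nat) : {poly R} :=
  match n with
  | 0 => 0
  | 1 => 'X
  | m.+1 => crit_poly R d m ^+ d + (-1) ^+ (d - 1) * 'X
  end.

(* Main.v *)
Require Import Defs.
From mathcomp Require Import all_boot all_order all_algebra all_field ring.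
Set Implicit Arguments.
Unset Strict Implicit.
Unset Printing Implicit Defensive.
Import GRing.Theory.
Local Open Scope ring_scope.

(** Write [q] for the order of [F] and [c_n] for [P_n(a)]. The theorem rests
    on two facts about the sequence [c_n].

    The first is a criterion for the single step from [f_n] to [f_(n+1)]. Let
    [g] be monic irreducible of degree [k] over [F] with [g(0) <> 0], and let
    [c = (-1)^k g(0)] be the norm to [F] of a root of [g]. If [4] does not
    divide [d], then [g(X^d)] is irreducible as soon as every prime [r]
    dividing [d] divides [q - 1] and [c ^ ((q - 1) / r) <> 1]
    ([irreducible_comp_Xn]); conversely irreducibility of [g(X^d)] forces
    these inequalities for the primes [r] dividing both [d] and [q - 1]
    ([irreducible_comp_Xn_power_neq1]). Here [c ^ ((q - 1) / r) = 1] says that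
    the nonzero element [c] is an [r]-th power in [F]. Since [f_(n+1)(X) =
    g(X^d)] for [g(X) = f_n(X - a)], whose norm [c] equals [c_(n+1)]
    ([signr_poly_iter0]), the irreducibility of all the iterates becomes a
    statement about the values [c_n]: none of them is an [r]-th power, for any
    prime [r] dividing [d]. That these primes divide [q - 1] follows from the
    irreducibility of [f] itself ([irreducible_XnsubC_prime_dvd]).

    The second fact is that there are few values to test. As [c_(n+1)] depends
    only on [c_n ^ d], and [F] has [(q - 1) / gcd(q - 1, d)] nonzero [d]-th
    powers, the pigeonhole principle makes the sequence periodic so early that
    its first [(q - 1) / gcd(q - 1, d) + 1] terms already contain every value
    it takes ([power_recurrence_range]).

    Both halves of the criterion are obtained by following a root [z] of
    [g(X^d)] under Frobenius. The number [x = z^d] has degree [k], so with [Q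
    = q^k] the element [w = z^(Q-1)] satisfies [w^d = 1] and [w^(d/r) =
    x^((Q-1)/r) = c^((q-1)/r)]. When all of these differ from [1], [w] has
    exact order [d]; if [z] has degree [k t], then [z^(Q^t) = z] gives [w^(1 +
    Q + ... + Q^(t-1)) = 1], hence [d] divides this geometric sum, and a
    lifting-the-exponent argument ([dvdn_geom_sum]) gives [d | t]. *)

(** * Divisibility of geometric sums *)

Lemma geom_sum_mod (r Q t : nat) :
  Q = 1 %[mod r] -> (\sum_(i < t) Q ^ i = t %[mod r])%N.
Proof.
move=> Q1; rewrite -modn_summ (eq_bigr (fun=> 1 %% r)%N).
  by rewrite modn_summ sum_nat_const card_ord muln1.
by move=> i _; rewrite -modnXm Q1 modnXm exp1n.
Qed.

Lemma geom_sum_mul (Q s t : nat) : (0 < Q)%N ->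
  (\sum_(i < s * t) Q ^ i = (\sum_(i < s) Q ^ i) * \sum_(i < t) (Q ^ s) ^ i)%N.
Proof.
case: Q => // -[_|Q _].
  under eq_bigr do rewrite exp1n.
  under [X in _ = (X * _)%N]eq_bigr do rewrite exp1n.
  under [X in _ = (_ * X)%N]eq_bigr do rewrite exp1n exp1n.
  by rewrite !sum_nat_const !card_ord !muln1.
apply/eqP; rewrite -(eqn_pmul2l (ltn0Sn Q)) mulnA -[Q.+1]/(Q.+2.-1).
by rewrite -!predn_exp expnM.
Qed.

(** By the binomial formula [Q ^ i] is [1 + i (Q - 1)] modulo [p ^ 2], and for
    odd [p] the sum of the [i < p], namely ['C(p, 2)], is a multiple of [p].
    For [p = 2] this last point fails, which is where the condition on [d]
    modulo [4] comes from. *)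
Lemma geom_sum_prime_mod (p Q : nat) : prime p -> odd p -> Q = 1 %[mod p] ->
  (0 < Q)%N -> (\sum_(i < p) Q ^ i = p %[mod p ^ 2])%N.
Proof.
move=> p_pr p_odd Q1 Q0; have p_gt0 := prime_gt0 p_pr.
have /dvdnP[u Du]: (p %| Q - 1)%N by rewrite -eqn_mod_dvd // Q1.
have{Du} ->: Q = (u * p).+1 by rewrite -Du subn1 prednK.
have pow i : ((u * p).+1 ^ i = 1 + i * (u * p) %[mod p ^ 2])%N.
  elim: i => [|i IH] //; rewrite expnS -modnMmr IH modnMmr.
  have ->: ((u * p).+1 * (1 + i * (u * p)) =
            (i * u ^ 2) * p ^ 2 + (1 + i.+1 * (u * p)))%N by ring.
  by rewrite modnMDl.
rewrite -modn_summ; under eq_bigr do rewrite pow.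
rewrite modn_summ big_split /= sum_nat_const card_ord muln1 -big_distrl /=.
rewrite -(big_mkord xpredT id) /= bin2_sum.
have /dvdnP[v ->]: (p %| 'C(p, 2))%N.
  by rewrite prime_dvd_bin //= odd_prime_gt2.
by rewrite addnC (_ : _ * _ = (v * u) * p ^ 2)%N ?modnMDl // !expnS; ring.
Qed.

(** Writing [t = p s], the sum factors as that of length [p] for [Q], which
    contains exactly one factor [p], times that of length [s] for [Q ^ p];
    induction on the exponent of [p] then applies to the latter. *)
Lemma dvdn_geom_sum_odd (p j : nat) : prime p -> odd p -> forall Q t,
  Q = 1 %[mod p] -> (0 < Q)%N ->
  (p ^ j %| \sum_(i < t) Q ^ i)%N -> (p ^ j %| t)%N.
Proof.
move=> p_pr p_odd; elim: j => [|j IH] Q t Q1 Q0 dv; first by rewrite dvd1n.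
have /dvdnP[s Dt]: (p %| t)%N.
  rewrite /dvdn -(geom_sum_mod t Q1); apply: dvdn_trans dv.
  by rewrite expnS dvdn_mulr.
have p_gt0 := prime_gt0 p_pr.
rewrite {}Dt mulnC in dv *; rewrite geom_sum_mul // in dv.
rewrite expnS dvdn_pmul2l //; apply: (IH (Q ^ p)%N) => //; last 2 first.
- by rewrite expn_gt0 Q0.
- have mod2 := geom_sum_prime_mod p_pr p_odd Q1 Q0.
  have /dvdnP[w Dw]: (p %| \sum_(i < p) Q ^ i)%N.
    by rewrite /dvdn (geom_sum_mod p Q1) modnn.
  rewrite Dw mulnAC mulnC expnS dvdn_pmul2l // in dv.
  rewrite -(@Gauss_dvdr _ w) // coprimeXl // prime_coprime //.
  (* A second factor p in the first sum would make it 0 modulo p ^ 2. *)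
  apply/negP => /dvdnP[w' Dw']; move/eqP: mod2; rewrite Dw Dw'.
  rewrite -mulnA mulnn modnMl modn_small ?[0 == _]eq_sym ?eqn0Ngt ?p_gt0 //.
  by rewrite -mulnn ltn_Pmull ?prime_gt1.
by rewrite -modnXm Q1 modnXm exp1n.
Qed.

(** It suffices to treat each prime power exactly dividing [d]. Odd primes are
    covered by the previous lemma; the power of [2] dividing [d] is at most
    [2], and then reduction modulo [2] is enough, as the sum is congruent to
    [t]. *)
Lemma dvdn_geom_sum (d Q t : nat) : (0 < d)%N -> ~~ (4 %| d)%N -> (0 < Q)%N ->
  (forall r, prime r -> (r %| d)%N -> (r %| Q - 1)%N) ->
  (d %| \sum_(i < t) Q ^ i)%N -> (d %| t)%N.
Proof.
move=> d_gt0 d4 Q0 dQ dv; apply/(dvdn_partP t d_gt0) => p p_d.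
have [p_pr _ p_dv] := and3P (etrans (esym (mem_primes p d)) p_d).
have Q1 : Q = 1 %[mod p] by apply/eqP; rewrite eqn_mod_dvd // dQ.
have {dv} : (d`_p %| \sum_(i < t) Q ^ i)%N := dvdn_trans (dvdn_part _ _) dv.
rewrite p_part; have [p_odd|p_even] := boolP (odd p).
  exact: dvdn_geom_sum_odd.
have p2 : p = 2 by apply/eqP; move: p_even; case/even_prime: p_pr => ->.
have : (logn p d <= 1)%N by rewrite leqNgt -pfactor_dvdn // p2.
case: (logn p d) => [|[|]] // _.
by rewrite expn1 /dvdn (geom_sum_mod t Q1).
Qed.

(** * Frobenius orbits and norms over a finite field *)

Section Frobenius.

Variables (F : finFieldType) (L : fieldExtType F).
Implicit Types (g : {poly F}) (x y : L).
Local Notation q := #|F|.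
Local Notation "p ^@" := (map_poly (in_alg L) p) (at level 2).

Lemma pchar_nat_card : [pchar L].-nat q.
Proof.
have [p p_pr pcharFp] := finPcharP F; rewrite (card_pprimeChar pcharFp).
have pcharLp : p \in [pchar L] by rewrite pchar_lalg.
by rewrite (eq_pnat _ (pcharf_eq pcharLp)) pnatX pnat_id.
Qed.

(** Taking [q]-th powers is additive on [L] and fixes the coefficients of [g]. *)
Lemma horner_Frobenius g x s : g^@.[x] ^+ (q ^ s) = g^@.[x ^+ (q ^ s)].
Proof.
elim: s => [|s IH]; first by rewrite !expr1.
rewrite expnSr !exprM {}IH; move: {x}(x ^+ _) => x.
elim/poly_ind: g => [|g c IH].
  by rewrite !rmorph0 !horner0 expr0n -leqn0 leqNgt ltnW ?finNzRing_gt1.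
rewrite !rmorphD !rmorphM /= map_polyX map_polyC /= !hornerE.
rewrite exprDn_pchar ?pchar_nat_card // exprMn IH.
by rewrite -in_algE -rmorphXn /= expf_card.
Qed.

Lemma root_Frobenius g x s : root g^@ x -> root g^@ (x ^+ (q ^ s)).
Proof.
rewrite !rootE -horner_Frobenius => /eqP->.
by rewrite expr0n expn_eq0 -leqn0 leqNgt ltnW ?finNzRing_gt1.
Qed.

Lemma mem_Frobenius_fixed x y s :
  x ^+ (q ^ s) = x -> y \in <<1; x>>%VS -> y ^+ (q ^ s) = y.
Proof. by move=> xs /Fadjoin1_polyP[g ->]; rewrite horner_Frobenius xs. Qed.

Lemma Frobenius_degree x : x ^+ (q ^ \dim <<1; x>>) = x.
Proof.
by apply/eqP; rewrite -(Fermat's_little_theorem <<1; x>>%AS) memv_adjoin.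
Qed.

(** All [q ^ k] elements of [F(x)], where [k] is the degree of [x], are then
    roots of ['X^(q ^ s) - 'X], which has at most [q ^ s] of them. *)
Lemma Frobenius_fixed_degree_leq x s :
  (0 < s)%N -> x ^+ (q ^ s) = x -> (\dim <<1; x>> <= s)%N.
Proof.
move=> s_gt0 xs; have q_gt1 := finNzRing_gt1 F.
have qs_gt1 : (1 < q ^ s)%N by rewrite -(exp1n s) ltn_exp2r.
rewrite -(leq_exp2l _ _ q_gt1).
pose K : {vspace finvect_type L} := <<1; x>>%VS.
rewrite -(card_vspace K) cardE -ltnS.
have sz : size ('X^(q ^ s) - 'X : {poly L}) = (q ^ s).+1.
  by rewrite size_polyDl ?size_polyN ?size_polyXn ?size_polyX.
rewrite -sz; apply: (@max_poly_roots L); last exact: enum_uniq.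
  by rewrite -size_poly_gt0 sz.
apply/allP => y; rewrite (@mem_enum (finvect_type L)) => Ky.
by rewrite rootE !hornerE ?hornerXn (mem_Frobenius_fixed xs Ky) subrr.
Qed.

(** If [i < j] gave the same conjugate, applying the remaining [k - i] steps
    of the [k]-cycle would show that [x] is fixed by the [(j - i)]-th power of
    Frobenius, too small a power by the previous lemma. *)
Lemma Frobenius_orbit_inj x i j :
  (i < \dim <<1; x>>)%N -> (j < \dim <<1; x>>)%N ->
  x ^+ (q ^ i) = x ^+ (q ^ j) -> i = j.
Proof.
wlog le_ij : i j / (i <= j)%N => [th_sym|] lt_i lt_j eq_ij.
  by have [/th_sym|/ltnW/th_sym/(_ lt_j lt_i (esym eq_ij))] := leqP i j; auto.
apply/eqP; rewrite eqn_leq le_ij leqNgt /=; apply/negP => lt_ij.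
have := leq_ltn_trans (leq_subr i j) lt_j; rewrite ltnNge => /negP; apply.
apply: Frobenius_fixed_degree_leq; first by rewrite subn_gt0.
set k := \dim _ in lt_i lt_j *; have xk := Frobenius_degree x.
rewrite -[in RHS]xk -/k -(subnKC (ltnW lt_i)) expnD exprM eq_ij -exprM -expnD.
have ->: (j + (k - i) = k + (j - i))%N.
  by rewrite addnBA 1?ltnW // addnC addnBA.
by rewrite expnD exprM xk.
Qed.

Lemma irreducible_root_dim g x :
  irreducible_poly g -> root g^@ x -> \dim <<1; x>> = (size g).-1.
Proof.
move=> [g_gt1 irr_g] gx.
have /polyOver1P[m Dm] := minPolyOver 1 x.
have sz_m : size m = (\dim <<1; x>>).+1.
  rewrite -(size_map_poly (in_alg L)) -Dm size_minPoly.
  by rewrite adjoin_degreeE dimv1 divn1.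
rewrite -(eqp_size (irr_g m _ _)) ?sz_m ?eqSS -?lt0n ?adim_gt0 //.
by rewrite -(dvdp_map (in_alg L)) -Dm minPoly_dvdp // alg_polyOver.
Qed.

(** The Frobenius conjugates of [x] are roots of [g], distinct and as many as
    its degree, so [g] splits as the product of the corresponding linear
    factors; the constant term gives the product of the conjugates, a power of
    [x]. *)
Lemma irreducible_root_norm g x : g \is monic -> irreducible_poly g ->
  root g^@ x ->
  x ^+ (\sum_(i < (size g).-1) q ^ i) = ((-1) ^+ (size g).-1 * g.[0])%:A.
Proof.
move=> g_mon irr_g gx; have dim_x := irreducible_root_dim irr_g gx.
set k := (size g).-1 in dim_x *.
pose rs := [seq x ^+ (q ^ i) | i <- index_iota 0 k].
have Dg : g^@ = \prod_(z <- rs) ('X - z%:P).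
  rewrite [LHS](@all_roots_prod_XsubC _ _ rs).
  - by rewrite lead_coef_map (monicP g_mon) rmorph1 scale1r.
  - rewrite size_map_poly size_map size_iota subn0 prednK // ltnW //.
    by case: irr_g.
  - by apply/allP => _ /mapP[i _ ->]; apply: root_Frobenius.
  rewrite uniq_rootsE map_inj_in_uniq ?iota_uniq // => i j.
  rewrite !mem_index_iota -dim_x /= => lt_i lt_j.
  exact: Frobenius_orbit_inj.
rewrite -in_algE rmorphM rmorphXn rmorphN1 -horner_map rmorph0 Dg.
rewrite horner_prod big_map big_mkord expr_sum.
under [in RHS]eq_bigr do rewrite hornerXsubC sub0r.
by rewrite prodrN card_ord mulrA -exprMn mulrNN mulr1 expr1n mul1r.
Qed.

End Frobenius.

(** * Irreducibility of g(X^d) *)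

Section PowerSubstitution.

Variables (F : finFieldType) (g : {poly F}) (d : nat).
Local Notation q := #|F|.
Local Notation k := (size g).-1.
Local Notation c := ((-1) ^+ k * g.[0]).
Hypotheses (g_mon : g \is monic) (g_irr : irreducible_poly g).
Hypothesis d_gt0 : (0 < d)%N.

Lemma size_comp_Xn : size (g \Po 'X^d) = (k * d).+1.
Proof.
rewrite -[d in RHS]/(d.+1.-1) -(size_polyXn F d) -size_comp_poly prednK //.
by rewrite size_poly_gt0 comp_poly_eq0 ?size_polyXn ?monic_neq0.
Qed.

Lemma root_comp_Xn (L : fieldExtType F) (z : L) :
  root (map_poly (in_alg L) (g \Po 'X^d)) z =
  root (map_poly (in_alg L) g) (z ^+ d).
Proof. by rewrite map_comp_poly map_polyXn root_comp hornerXn. Qed.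

(** The exponent [(q ^ k - 1) / r] is [(q - 1) / r] times the geometric sum
    that turns a root [x] into its norm [c]: this reduces the test for [r]-th
    powers in [F(x)] to the one in [F]. *)
Lemma norm_power (L : fieldExtType F) (x : L) r : (r %| q - 1)%N ->
  root (map_poly (in_alg L) g) x ->
  x ^+ ((q ^ k - 1) %/ r) = (c ^+ ((q - 1) %/ r))%:A.
Proof.
move=> r_q gx; rewrite -in_algE rmorphXn /=.
rewrite -(irreducible_root_norm g_mon g_irr gx).
by rewrite -exprM !subn1 predn_exp -!subn1 mulnC muln_divA // mulnC.
Qed.

(** Otherwise [y = z ^ (d / r)] satisfies [y ^ (Q - 1) = 1], where [Q = q ^
    k], so it is fixed by [Q]-th powers. The [d] conjugates [z ^ (Q ^ i)], [i
    < d], distinct since [z] has degree [k d], would then all be roots of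
    ['X^(d / r) - y], which has too small a degree. *)
Lemma irreducible_comp_Xn_power_neq1 r : irreducible_poly (g \Po 'X^d) ->
  prime r -> (r %| d)%N -> (r %| q - 1)%N -> c ^+ ((q - 1) %/ r) != 1.
Proof.
move=> G_irr r_pr r_d r_q; apply/eqP => cr1.
have [L _ [z Gz _]] := irredp_FAdjoin G_irr.
have dim_z : \dim <<1; z>> = (k * d)%N.
  by rewrite (irreducible_root_dim G_irr Gz) size_comp_Xn.
have k_gt0 : (0 < k)%N by have [] := g_irr; case: (size g) => [|[]].
have q_gt0 : (0 < q)%N by rewrite ltnW ?finNzRing_gt1.
have Q_gt0 : (0 < q ^ k)%N by rewrite expn_gt0 q_gt0.
have r_Q : (r %| q ^ k - 1)%N.
  by apply: dvdn_trans r_q _; rewrite !subn1 dvdn_pred_predX.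
set e := (d %/ r)%N; pose y := z ^+ e.
have yQ1 : y ^+ (q ^ k - 1) = 1.
  rewrite -exprM divn_mulAC // -muln_divA // exprM norm_power -?root_comp_Xn //.
  by rewrite cr1 scale1r.
have yQ i : y ^+ (q ^ (k * i)) = y.
  rewrite expnM -(subnK Q_gt0) addn1.
  elim: i => [|i IH]; first by rewrite expr1.
  by rewrite expnS exprM exprS yQ1 mulr1.
have e_gt0 : (0 < e)%N.
  by rewrite /e divn_gt0 ?(prime_gt0 r_pr) // (dvdn_leq d_gt0 r_d).
pose rs := [seq z ^+ (q ^ (k * i)) | i <- iota 0 d].
have : (size rs < size ('X^e - y%:P)%R)%N.
  apply: max_poly_roots; first by rewrite -size_poly_gt0 size_XnsubC.
  - apply/allP => _ /mapP[i _ ->].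
    by rewrite rootE !hornerE ?hornerXn exprAC yQ subrr.
  rewrite map_inj_in_uniq ?iota_uniq // => i j.
  rewrite !mem_iota !add0n /= => lt_i lt_j /Frobenius_orbit_inj.
  rewrite dim_z !ltn_pmul2l // => /(_ lt_i lt_j)/eqP.
  by rewrite eqn_pmul2l // => /eqP.
rewrite size_XnsubC // size_map size_iota ltnS leqNgt ltn_Pdiv ?prime_gt1 //.
Qed.

(** The root of unity [w = z ^ (Q - 1)], with [Q = q ^ k], measures how far
    [z] is from lying in the field of order [Q] generated by [z ^ d]. The
    hypotheses on [c] make its order exactly [d], and [t], the degree of [z]
    over that field, satisfies [w ^ (1 + Q + ... + Q ^ (t - 1)) = z ^ (Q ^ t -
    1) = 1]. *)
Lemma root_comp_Xn_dim (L : fieldExtType F) (z : L) :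
  ~~ (4 %| d)%N -> g.[0] != 0 ->
  (forall r, prime r -> (r %| d)%N ->
     (r %| q - 1)%N /\ c ^+ ((q - 1) %/ r) != 1) ->
  root (map_poly (in_alg L) (g \Po 'X^d)) z -> (k * d <= \dim <<1; z>>)%N.
Proof.
move=> d4 g0 hr; rewrite root_comp_Xn => gx; pose x := z ^+ d.
have dim_x : \dim <<1; x>> = k := irreducible_root_dim g_irr gx.
have k_gt0 : (0 < k)%N by rewrite -dim_x adim_gt0.
have q_gt0 : (0 < q)%N by rewrite ltnW ?finNzRing_gt1.
have Q_gt0 : (0 < q ^ k)%N by rewrite expn_gt0 q_gt0.
have z_neq0 : z != 0.
  apply: contra_neq g0 => z0; move: gx.
  rewrite z0 expr0n gtn_eqF // rootE !horner_coef0.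
  by rewrite coef_map fmorph_eq0 => /eqP.
have sub_xz : (<<1; x>> <= <<1; z>>)%VS.
  by apply/FadjoinP; rewrite sub1v rpredX ?memv_adjoin.
have /dvdnP[t dim_z] := field_dimS sub_xz; rewrite dim_x mulnC in dim_z.
have t_gt0 : (0 < t)%N.
  by have := adim_gt0 <<1; z>>%AS; rewrite /= dim_z muln_gt0 => /andP[].
rewrite dim_z leq_pmul2l // dvdn_leq //.
have xQ1 : x ^+ (q ^ k - 1) = 1.
  apply: (mulfI (expf_neq0 d z_neq0)); rewrite -exprS -addn1 subnK // mulr1.
  by rewrite -dim_x Frobenius_degree.
pose w := z ^+ (q ^ k - 1).
have wd : w ^+ d = 1 by rewrite exprAC.
have [m w_prim m_d] := prim_order_exists d_gt0 wd.
have m_gt0 := prim_order_gt0 w_prim.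
have Dm : m = d.
  suff /eqP dm1 : (d %/ m == 1)%N by rewrite -[RHS](divnK m_d) dm1 mul1n.
  apply: contraT => dm_neq1.
  have r_pr : prime (pdiv (d %/ m)).
    by rewrite pdiv_prime // ltn_neqAle eq_sym dm_neq1 divn_gt0 // dvdn_leq.
  set r := pdiv _ in r_pr; have r_dm : (r %| d %/ m)%N := pdiv_dvd _.
  have r_d : (r %| d)%N := dvdn_trans r_dm (dvdn_div m_d).
  have [r_q] := hr r r_pr r_d; rewrite -(fmorph_eq1 (in_alg L)) /=.
  rewrite -(norm_power r_q gx) -exprM muln_divA; last first.
    by apply: dvdn_trans r_q _; rewrite !subn1 dvdn_pred_predX.
  rewrite mulnC -muln_divA // exprM -(prim_order_dvd w_prim).
  by rewrite dvdn_divRL // mulnC -dvdn_divRL // => /negP[].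
apply: (dvdn_geom_sum (Q := (q ^ k)%N)) => // [r r_pr r_d|].
  have [r_q _] := hr r r_pr r_d.
  by apply: dvdn_trans r_q _; rewrite !subn1 dvdn_pred_predX.
rewrite -Dm (prim_order_dvd w_prim) -exprM subn1 -predn_exp -expnM -dim_z.
apply/eqP/(mulfI z_neq0); rewrite -exprS prednK ?expn_gt0 ?q_gt0 // mulr1.
exact: Frobenius_degree.
Qed.

(** A nonconstant divisor [h] has a root in a splitting field of [g(X^d)];
    that root already has degree at least that of [g(X^d)], so [h] is
    everything. *)
Lemma irreducible_comp_Xn : ~~ (4 %| d)%N -> g.[0] != 0 ->
  (forall r, prime r -> (r %| d)%N ->
     (r %| q - 1)%N /\ c ^+ ((q - 1) %/ r) != 1) ->
  irreducible_poly (g \Po 'X^d).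
Proof.
move=> d4 g0 hr; set G := g \Po 'X^d; have sG : size G = _ := size_comp_Xn.
have k_gt0 : (0 < k)%N by have [] := g_irr; case: (size g) => [|[]].
split=> [|h h_neq1 h_G]; first by rewrite sG ltnS muln_gt0 k_gt0.
have G_neq0 : G != 0 by rewrite -size_poly_gt0 sG.
have [L [rs DG _]] := FinSplittingFieldFor G_neq0.
have [z hz] : exists z : L, root (map_poly (in_alg L) h) z.
  have : map_poly (in_alg L) h %| \prod_(x <- rs) ('X - x%:P).
    by rewrite -(eqp_dvdr _ DG) dvdp_map.
  case/dvdp_prod_XsubC => m; case: (mask m rs) => [|z s] Dh.
    have := eqp_size Dh; rewrite size_map_poly big_nil size_poly1 => /eqP.
    by rewrite (negPf h_neq1).
  by exists z; rewrite (eqp_root Dh) root_prod_XsubC mem_head.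
have Gz : root (map_poly (in_alg L) G) z.
  by apply: root_dvdp hz; rewrite dvdp_map.
have h_neq0 : h != 0 by apply: dvdpN0 h_G G_neq0.
rewrite -dvdp_size_eqp // eqn_leq dvdp_leq //= sG.
apply: leq_ltn_trans (root_comp_Xn_dim d4 g0 hr Gz) _.
have := dvdp_leq _ (minPoly_dvdp (alg_polyOver 1 h) hz).
rewrite size_map_poly size_minPoly adjoin_degreeE dimv1 divn1 => -> //.
by rewrite map_poly_eq0.
Qed.

End PowerSubstitution.

(** * The iterates of X^d - a *)

Lemma irreducible_comp_XsubC (K : fieldType) (p : {poly K}) (c : K) :
  irreducible_poly p -> irreducible_poly (p \Po ('X - c%:P)).
Proof.
have sX (b : K) : size ('X - b%:P) = 2 by rewrite size_XsubC.
move=> [p_gt1 p_irr]; split=> [|h]; first by rewrite size_comp_poly2.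
rewrite -(size_comp_poly2 h (sX (- c))) => /p_irr h_irr h_p.
have tK (r : {poly K}) (b : K) : (r \Po ('X - b%:P)) \Po ('X - (- b)%:P) = r.
  rewrite -comp_polyA comp_polyB comp_polyX comp_polyC.
  by rewrite polyCN opprK addrK comp_polyXr.
have h_eq : h \Po ('X - (- c)%:P) %= p.
  by apply: h_irr; rewrite -[p](tK p c) dvdp_comp_poly.
have /andP[h1 h2] := h_eq.
rewrite -[h](tK h (- c)) opprK.
by apply/andP; split; apply: dvdp_comp_poly.
Qed.

Lemma expf_pred_card (F : finFieldType) (x : F) : x != 0 -> x ^+ (#|F| - 1) = 1.
Proof.
move=> x_neq0; apply: (mulfI x_neq0).
by rewrite -exprS -addn1 subnK ?expf_card ?mulr1 // ltnW ?finNzRing_gt1.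
Qed.

(** When [r] is coprime to [q - 1], every element of [F] is an [r]-th power;
    writing [a = b ^ r] exhibits ['X^(d / r) - b] as a proper divisor of ['X^d
    - a]. *)
Lemma irreducible_XnsubC_prime_dvd (F : finFieldType)
    (d : nat) (a : F) (r : nat) :
  a != 0 -> (0 < d)%N -> irreducible_poly ('X^d - a%:P) ->
  prime r -> (r %| d)%N -> (r %| #|F| - 1)%N.
Proof.
move=> a_neq0 d_gt0 [_ irr] r_pr r_d; apply: contraT.
rewrite -prime_coprime // => co.
have r_gt0 := prime_gt0 r_pr.
have [u v Duv _] := egcdnP (#|F| - 1) r_gt0.
rewrite (eqnP co) in Duv.
have Da : a = (a ^+ u) ^+ r.
  by rewrite -exprM Duv exprD mulnC exprM expf_pred_card // expr1n mul1r.
have e_gt0 : (0 < d %/ r)%N by rewrite divn_gt0 // dvdn_leq.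
have := irr ('X^(d %/ r) - (a ^+ u)%:P).
rewrite size_XnsubC // eqSS -lt0n e_gt0.
have -> : 'X^d - a%:P = ('X^(d %/ r)) ^+ r - ((a ^+ u)%:P) ^+ r :> {poly F}.
  by rewrite -exprM divnK // -rmorphXn /= -Da.
rewrite subrXX dvdp_mulr // => /(_ isT isT)/eqp_size.
rewrite -subrXX -exprM divnK // -rmorphXn /= -Da !size_XnsubC // => -[] de.
by move: (ltn_Pdiv (prime_gt1 r_pr) d_gt0); rewrite de ltnn.
Qed.

Section Iterates.

Variables (F : finFieldType) (d : nat) (a : F).
Hypothesis d_gt0 : (0 < d)%N.
Local Notation f := ('X^d - a%:P).

(** Expanding the iteration on the outside is what makes the values at [0]
    satisfy the recurrence of the polynomials [P_n]. *)
Lemma poly_iterSr n : poly_iter f n.+1 = f \Po poly_iter f n.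
Proof.
elim: n => [|n IH]; first by rewrite /= comp_polyX comp_polyXr.
by rewrite [LHS]/= -/(poly_iter f n.+1) {1}IH -comp_polyA.
Qed.

Lemma poly_iter_monic n : poly_iter f n \is monic.
Proof.
elim: n => [|n IH]; first exact: monicX.
rewrite /= monicE lead_coef_comp ?size_XnsubC //.
by rewrite (monicP IH) (monicP (monicXnsubC a d_gt0)) expr1n mulr1.
Qed.

Lemma size_poly_iter n : (size (poly_iter f n)).-1 = (d ^ n)%N.
Proof.
elim: n => [|n IH]; first by rewrite size_polyX.
by rewrite /= size_comp_poly IH size_XnsubC // expnSr.
Qed.

Lemma poly_iter0 n : (poly_iter f n.+1).[0] = (poly_iter f n).[- a].
Proof. by rewrite /= horner_comp !hornerE expr0n gtn_eqF // sub0r. Qed.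

(** The left-hand side is the norm of a root of [f_n(X - a)], a polynomial of
    degree [d ^ n] with constant term [f_(n+1)(0)]. For [n > 0] the sign only
    records the parity of [d], which is that of [d ^ n]. *)
Lemma signr_poly_iter0 n :
  (-1) ^+ (d ^ n) * (poly_iter f n.+1).[0] = (crit_poly F d n.+1).[a].
Proof.
elim: n => [|n IH].
  by rewrite poly_iter0 /= !hornerX expr1 mulN1r opprK.
rewrite poly_iterSr horner_comp [crit_poly _ _ _]/= -/(crit_poly F d n.+1).
rewrite !hornerE -IH exprMn -exprM -expnSr mulrBr; congr (_ + _).
rewrite -mulNr; congr (_ * _); rewrite -[in LHS]signr_odd oddX /=.
rewrite -[in RHS](signr_odd _ (d - 1)) oddB // addbT.
by case: (odd d); rewrite ?expr1 ?opprK // expr0.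
Qed.

Lemma poly_iter_shift n :
  poly_iter f n.+1 = (poly_iter f n \Po ('X - a%:P)) \Po 'X^d.
Proof. by rewrite -comp_polyA comp_polyB comp_polyX comp_polyC. Qed.

End Iterates.

(** * Early repetition and stability *)

(** The [d]-th powers of nonzero elements are roots of ['X^e - 1] with [e = (q
    - 1) / gcd (q - 1, d)], so two of the powers [u i ^+ d], [i <= e],
    coincide. The sequence is periodic from the term after the first of them
    on, and indices beyond [e] can be lowered by multiples of the period. *)
Lemma power_recurrence_range (F : finFieldType) (d : nat) (u : nat -> F) :
  (forall n, u n != 0) ->
  (forall i j, u i ^+ d = u j ^+ d -> u i.+1 = u j.+1) ->
  forall n, exists2 i, (i <= (#|F| - 1) %/ gcdn (#|F| - 1) d)%N & u i = u n.
Proof.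
move=> u_neq0 u_rec; set e := (_ %/ _)%N.
have q_gt0 : (0 < #|F| - 1)%N by rewrite subn_gt0 finNzRing_gt1.
have delta_gt0 : (0 < gcdn (#|F| - 1) d)%N by rewrite gcdn_gt0 q_gt0.
have e_gt0 : (0 < e)%N by rewrite divn_gt0 // dvdn_leq ?dvdn_gcdl.
have [i [j [lt_ij le_je eq_ij]]] :
    exists i j, [/\ (i < j)%N, (j <= e)%N & u i ^+ d = u j ^+ d].
  have : ~~ uniq [seq u i ^+ d | i <- iota 0 e.+1].
    apply/negP => uniq_us.
    suff us_roots : all (root ('X^e - 1%:P)) [seq u i ^+ d | i <- iota 0 e.+1].
      have := max_poly_roots _ us_roots uniq_us.
      rewrite -size_poly_gt0 size_XnsubC // size_map size_iota ltnn.
      by move/(_ isT).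
    apply/allP => _ /mapP[i _ ->]; rewrite rootE !hornerE -exprM.
    rewrite (_ : d * e = (#|F| - 1) * (d %/ gcdn (#|F| - 1) d))%N; last first.
      by rewrite [RHS]muln_divCA_gcd.
    by rewrite exprM expf_pred_card // expr1n subrr.
  case/(uniqPn 0) => i [j []]; rewrite size_map size_iota => lt_ij lt_je.
  rewrite !(nth_map 0%N) ?size_iota ?(ltn_trans lt_ij) //.
  rewrite !nth_iota ?(ltn_trans lt_ij) //.
  by exists i, j.
have per n : u (i.+1 + n)%N = u (j.+1 + n)%N.
  elim: n => [|n IH]; first by rewrite !addn0; apply: u_rec.
  by rewrite !addnS; apply: u_rec; rewrite IH.
elim/ltn_ind => n IH; have [le_ne|lt_en] := leqP n e; first by exists n.
have lt_jn := leq_ltn_trans le_je lt_en.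
have [|m le_me um] := IH (i.+1 + (n - j.+1))%N.
  by rewrite -[X in (_ < X)%N](subnKC lt_jn) ltn_add2r ltnS.
by exists m; rewrite // um per subnKC.
Qed.

Theorem theorem4p5 (q : nat) (F : finFieldType) (hq : #|F| = q)
    (d : nat) (hd2 : (2 <= d)%N) (hd4 : (d <> 0 %[mod 4])%N)
    (a : F) (ha : a != 0) (f : {poly F}) (hf : f = 'X^d - a%:P)
    (delta : nat) (hdelta : delta = gcdn (q - 1) d)
    (hP : forall n : nat, (0 < n)%N -> (crit_poly F d n).[a] != 0)
    (hirr : forall n : nat, (1 <= n <= (q - 1) %/ delta + 1)%N ->
      irreducible_poly (poly_iter f n)) :
  stable f.
Proof.
subst q f delta; set f := _ - _ in hirr *.
have d_gt0 : (0 < d)%N := ltnW hd2.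
have d4 : ~~ (4 %| d)%N by apply/negP => /eqP d0; apply: hd4; rewrite d0 mod0n.
pose u n := (crit_poly F d n.+1).[a].
have u_neq0 n : u n != 0 by apply: hP.
have u_rec i j : u i ^+ d = u j ^+ d -> u i.+1 = u j.+1.
  by rewrite /u => eq_ij; rewrite 2!hornerD !horner_exp eq_ij.
pose g n := poly_iter f n \Po ('X - a%:P).
have g0 n : (-1) ^+ (size (g n)).-1 * (g n).[0] = u n.
  rewrite /u -signr_poly_iter0 // poly_iter0 // size_comp_poly2 ?size_XsubC //.
  by rewrite size_poly_iter // horner_comp !hornerE.
have g_mon n : g n \is monic.
  rewrite monicE lead_coef_comp ?size_XsubC //.
  by rewrite (monicP (poly_iter_monic a d_gt0 n)) lead_coefXsubC expr1n mulr1.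
have Df n : poly_iter f n.+1 = g n \Po 'X^d by apply: poly_iter_shift.
have irr0 : irreducible_poly (poly_iter f 0).
  by have := irredp_XsubC (0 : F); rewrite polyC0 subr0.
have irr_le n : (n <= (#|F| - 1) %/ gcdn (#|F| - 1) d + 1)%N ->
    irreducible_poly (poly_iter f n).
  by case: n => [|n] // le_n; apply: hirr.
have r_q r : prime r -> (r %| d)%N -> (r %| #|F| - 1)%N.
  apply: (irreducible_XnsubC_prime_dvd ha d_gt0).
  by rewrite -/f -[f]comp_polyX; apply: (irr_le 1%N); rewrite addn1.
(* Periodicity carries the test for r-th powers from the iterates assumed
   irreducible to all indices. *)
have u_nonpower n r : prime r -> (r %| d)%N -> u n ^+ ((#|F| - 1) %/ r) != 1.
  move=> r_pr r_d; have [i le_i <-] := power_recurrence_range u_neq0 u_rec n.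
  rewrite -g0.
  apply: (irreducible_comp_Xn_power_neq1 (d := d)) => //; last exact: r_q.
    by apply: irreducible_comp_XsubC; apply: irr_le; rewrite addn1 leqW.
  by rewrite -Df; apply: irr_le; rewrite addn1.
elim=> [|n IH] //; rewrite Df; apply: irreducible_comp_Xn => //.
- exact: irreducible_comp_XsubC.
- by have := u_neq0 n; rewrite -g0 mulf_eq0 negb_or => /andP[].
by move=> r r_pr r_d; rewrite g0; split; [apply: r_q | apply: u_nonpower].
Qed.
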